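(* For every positive integer $n$, $$\frac1{n!}=\sum_{\ell_1=1}^{n} \frac1{\ell_1}\sum_{\ell_2=1}^{\ell_1-1}\frac1{\ell_2}\dotsm \sum_{\ell_{n-1}=1}^{\ell_{n-2}-1}\frac1{\ell_{n-1}} \sum_{\ell_{n}=1}^{\ell_{n-1}-1}\frac1{\ell_{n}}.$$
   Context: The right-hand side is a nested sum of depth $n$, i.e. the sum of $\frac{1}{\ell_1\ell_2\cdots\ell_n}$ over all integers $n\ge\ell_1>\ell_2>\dots>\ell_n\ge1$; empty inner sums are $0$. *)

(* Defs.v *)
From mathcomp Require Import all_boot all_order all_algebra.

Set Implicit Arguments.
Unset Strict Implicit.
Unset Printing Implicit Defensive.

Import GRing.Theory.
Local Open Scope ring_scope.

(* Depth-d nested sum with outermost index running over 1 <= l <= N: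
     \sum_(l_1 = 1 .. N) 1/l_1 \sum_(l_2 = 1 .. l_1 - 1) 1/l_2 ...
       \sum_(l_d = 1 .. l_(d-1) - 1) 1/l_d.
   At depth 0 no summation sign is left, and the empty product is 1. *)
Fixpoint nested_sum (d N : nat) : rat :=
  if d is d'.+1 then
    \sum_(1 <= l < N.+1) (1 / l%:R * nested_sum d' l.-1)
  else 1.

(* Main.v *)
(* A strictly decreasing chain of n indices in {1, ..., n} is forced to be
   n > n - 1 > ... > 1, so only one summand survives. *)
Require Import Defs.
From mathcomp Require Import all_boot all_order all_algebra.

Import GRing.Theory.
Local Open Scope ring_scope.

(** Too few integers are available for [d] strictly decreasing indices once [N < d], so such sums
    vanish ([nested_sum_gt]). On the diagonal this leaves only the largest outer index, giving the
    recursion S(n+1) = S(n)/(n+1) with S(0) = 1, which is that of 1/n!. *)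

Lemma nested_sum_gt (d N : nat) : (N < d)%N -> nested_sum d N = 0.
Proof.
elim: d N => [//|d IHd] N ltNd /=.
rewrite big_nat big1 // => -[//|l] /andP[_ ltlN].
by rewrite IHd ?mulr0 //; exact: leq_trans ltlN ltNd.
Qed.

Lemma nested_sum_diag (n : nat) : nested_sum n n = (n`!)%:R^-1.
Proof.
elim: n => [|n IHn]; first by rewrite invr1.
(* Isolate the top index n+1; any smaller index leaves fewer than n values for the n inner
   indices. *)
rewrite [LHS]/= big_nat_recr //= big_nat big1 ?add0r => [|[//|l] /andP[_ ltln]].
  by rewrite IHn factS natrM invfM mul1r.
by rewrite nested_sum_gt ?mulr0.
Qed.

Theorem corollary2p2 (n : nat) (hn : (0 < n)%N) :
  1 / (n`!)%:R = nested_sum n n.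
Proof. by rewrite nested_sum_diag div1r. Qed.
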